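(* Let $p$ be a fixed prime, $\mathbb{F}=\mathbb{F}_p$, and let $c(\cdot)$ be a function of bilinear Bogolyubov type (as defined in the context). Let $\psi:\mathbb{F}^n\times\mathbb{F}^n\rightarrow \mathrm{Mat}_m(\mathbb{F})$ be a bilinear map. Suppose that the set $$P_\epsilon=\{(f,g)\in\mathbb{F}^n\times\mathbb{F}^n\mid \mathrm{rank}(\psi(f,g))\leq\epsilon\}$$ has density $\delta>0$ in $\mathbb{F}^n\times\mathbb{F}^n$. Then the set $$P_{64\epsilon}=\{(f,g)\in\mathbb{F}^n\times\mathbb{F}^n\mid \mathrm{rank}(\psi(f,g))\leq 64\epsilon\}$$ contains a set of the form $$\{(x,y)\in W_1\times W_2\mid Q_1(x,y)=\cdots=Q_{r_3}(x,y)=0\},$$ where $W_1,W_2\leq \mathbb{F}^n$ are subspaces, $Q_1,\ldots,Q_{r_3}$ are bilinear forms on $W_1\times W_2$, and the codimensions of $W_1$ and $W_2$ and the number $r_3$ of bilinear forms are all at most $c(\delta)$.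
   Context: $\mathrm{Mat}_m(\mathbb{F})$ is the space of $m\times m$ matrices over $\mathbb{F}$. For a finite-dimensional $\mathbb{F}$-vector space $V$ and $P\subset V\times V$, let $\phi_V(P)=\{(x,y_1+y_2-y_3-y_4)\mid (x,y_i)\in P,\ i=1,\dots,4\}$ and $\phi_H(P)=\{(x_1+x_2-x_3-x_4,y)\mid (x_i,y)\in P,\ i=1,\dots,4\}$. A function $c$ assigning to each $\delta>0$ a constant $c(\delta)>0$ is said to be of bilinear Bogolyubov type if for every finite-dimensional $\mathbb{F}$-vector space $V$ and every $P\subset V\times V$ of density $\delta=|P|/|V|^2>0$, there exist subspaces $W_1,W_2\leq V$ of codimensions $r_1,r_2$ and bilinear forms $Q_1,\ldots,Q_{r_3}$ on $W_1\times W_2$ with $\max(r_1,r_2,r_3)\leq c(\delta)$ and $\phi_H(\phi_V(\phi_H(P)))\supset\{(x,y)\in W_1\times W_2\mid Q_1(x,y)=\cdots=Q_{r_3}(x,y)=0\}$. (The paper's main theorem asserts that such a function exists; the $c(\delta)$ in this corollary is the one from that theorem.) *)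

(* Defs.v *)
From HB Require Import structures.
From mathcomp Require Import all_boot all_order all_algebra all_field.
From mathcomp Require Import sesquilinear reals.

Set Implicit Arguments.
Unset Strict Implicit.
Unset Printing Implicit Defensive.

Import Order.TTheory GRing.Theory Num.Theory.

Local Open Scope ring_scope.

Definition phiV (T : finZmodType) (P : {set T * T}) : {set T * T} :=
  [set u : T * T |
    [exists y1 : T, exists y2 : T, exists y3 : T, exists y4 : T,
      [&& (u.1, y1) \in P, (u.1, y2) \in P, (u.1, y3) \in P, (u.1, y4) \in P
        & u.2 == y1 + y2 - y3 - y4]]].

Definition phiH (T : finZmodType) (P : {set T * T}) : {set T * T} :=
  [set u : T * T |
    [exists x1 : T, exists x2 : T, exists x3 : T, exists x4 : T,
      [&& (x1, u.2) \in P, (x2, u.2) \in P, (x3, u.2) \in P, (x4, u.2) \in P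
        & u.1 == x1 + x2 - x3 - x4]]].

Definition density (R : realType) (T : finType) (P : {set T * T}) : R :=
  #|P|%:R / #|T|%:R ^+ 2.

Definition codim (F : fieldType) (V : vectType F) (W : {vspace V}) : nat :=
  (\dim {:V} - \dim W)%N.

(* The forms live on W1 x W2 only; [vsproj W] is the inverse of the inclusion  *)
(* [vsval] on vectors of W, and its values outside W are irrelevant here.      *)
Definition bilinear_zeros (F : fieldType) (V : vectType F) (W1 W2 : {vspace V})
    (r : nat)
    (Q : 'I_r -> {bilinear subvs_of W1 -> subvs_of W2 -> F | *%R & *%R}) :
    pred (V * V) :=
  [pred u | [&& u.1 \in W1, u.2 \in W2
    & [forall i, Q i (vsproj W1 u.1) (vsproj W2 u.2) == 0]]].

(* [finvect_type V] is V itself, equipped with the finite type structure that  *)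
(* it inherits from the finite field F.                                        *)
Definition bilinear_bogolyubov_type (R : realType) (F : finFieldType)
    (c : R -> R) : Prop :=
  (forall delta : R, 0 < delta -> 0 < c delta) /\
  forall (V : vectType F) (P : {set finvect_type V * finvect_type V}),
    0 < density R P ->
    exists (W1 W2 : {vspace V}) (r3 : nat)
      (Q : 'I_r3 -> {bilinear subvs_of W1 -> subvs_of W2 -> F | *%R & *%R}),
      (maxn (codim W1) (maxn (codim W2) r3))%:R <= c (density R P) /\
      {subset bilinear_zeros Q <= phiH (phiV (phiH P))}.

Definition low_rank_set (R : realType) (F : finFieldType) (n m : nat)
    (psi : {bilinear 'rV[F]_n -> 'rV[F]_n -> 'M[F]_m}) (eps : R) :
    {set 'rV[F]_n * 'rV[F]_n} :=
  [set u | (\rank (psi u.1 u.2))%:R <= eps].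

(* Main.v *)
Require Import Defs.
From HB Require Import structures.
From mathcomp Require Import all_boot all_order all_algebra all_field.
From mathcomp Require Import sesquilinear reals.

Set Implicit Arguments.
Unset Strict Implicit.
Unset Printing Implicit Defensive.

Import Order.TTheory GRing.Theory Num.Theory.

Local Open Scope ring_scope.

(** If [psi] is biadditive, each application of [phiH] or [phiV] multiplies a
    bound on the rank of [psi] by at most four: with one coordinate fixed, the
    other is a signed sum of four vectors, which [psi] turns into a signed sum
    of four matrices already known to have small rank, and rank is subadditive.
    Starting from the set [P] of rank at most [eps], the iterate
    [phiH (phiV (phiH P))] therefore consists of pairs of rank at most
    [4 * 4 * 4 * eps = 64 * eps].  The bilinear Bogolyubov property places
    inside this iterate the common zero set of few bilinear forms on two
    subspaces of small codimension. *)

Lemma mxrank_signed_sum4 (R : numDomainType) (F : fieldType) (m n : nat)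
    (A1 A2 A3 A4 : 'M[F]_(m, n)) (e : R) :
    (\rank A1)%:R <= e -> (\rank A2)%:R <= e ->
    (\rank A3)%:R <= e -> (\rank A4)%:R <= e ->
  (\rank (A1 + A2 - A3 - A4)%R)%:R <= 4 * e.
Proof.
move=> le1 le2 le3 le4.
have -> : 4 * e = e + e + e + e by rewrite mulr_natl 3!mulrSr mulr1n.
apply: le_trans (lerD (lerD (lerD le1 le2) le3) le4).
rewrite -!natrD ler_nat -(mxrank_opp A3) -(mxrank_opp A4).
by do 3![apply: leq_trans (mxrank_add _ _) _; rewrite ?leq_add2r //].
Qed.

Lemma zmod_morphism_signed_sum4 (U V : zmodType) (g : U -> V) :
    zmod_morphism g ->
  forall x1 x2 x3 x4, g (x1 + x2 - x3 - x4) = g x1 + g x2 - g x3 - g x4.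
Proof.
move=> gB x1 x2 x3 x4.
pose G : {additive U -> V} := HB.pack g (GRing.isZmodMorphism.Build U V g gB).
by rewrite -[g]/(G : U -> V) !raddfB raddfD.
Qed.

Section RankGrowth.

Variables (R : numDomainType) (F : fieldType) (m n : nat) (T : finZmodType).
Variables (f : T -> T -> 'M[F]_(m, n)).
Implicit Types (P : {set T * T}) (e : R).

Lemma phiH_rank_le P e :
    (forall y, zmod_morphism (f^~ y)) ->
    {in P, forall u, (\rank (f u.1 u.2))%:R <= e} ->
  {in phiH P, forall u, (\rank (f u.1 u.2))%:R <= 4 * e}.
Proof.
move=> fBl leP [x y]; rewrite inE /=.
case/existsP=> x1 /existsP[x2 /existsP[x3 /existsP[x4]]].
case/and5P=> P1 P2 P3 P4 /eqP->.
rewrite (zmod_morphism_signed_sum4 (fBl y)).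
by apply: mxrank_signed_sum4; [have := leP _ P1 | have := leP _ P2
  | have := leP _ P3 | have := leP _ P4].
Qed.

Lemma phiV_rank_le P e :
    (forall x, zmod_morphism (f x)) ->
    {in P, forall u, (\rank (f u.1 u.2))%:R <= e} ->
  {in phiV P, forall u, (\rank (f u.1 u.2))%:R <= 4 * e}.
Proof.
move=> fBr leP [x y]; rewrite inE /=.
case/existsP=> y1 /existsP[y2 /existsP[y3 /existsP[y4]]].
case/and5P=> P1 P2 P3 P4 /eqP->.
rewrite (zmod_morphism_signed_sum4 (fBr x)).
by apply: mxrank_signed_sum4; [have := leP _ P1 | have := leP _ P2
  | have := leP _ P3 | have := leP _ P4].
Qed.

Lemma phiHVH_rank_le P e :
    (forall y, zmod_morphism (f^~ y)) -> (forall x, zmod_morphism (f x)) ->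
    {in P, forall u, (\rank (f u.1 u.2))%:R <= e} ->
  {in phiH (phiV (phiH P)), forall u, (\rank (f u.1 u.2))%:R <= 64 * e}.
Proof.
move=> fBl fBr leP.
have -> : 64 * e = 4 * (4 * (4 * e)) by rewrite !mulrA -!natrM.
exact/phiH_rank_le/phiV_rank_le/phiH_rank_le.
Qed.

End RankGrowth.

(** A finite vector space may carry two finite type structures, with distinct
    enumerations: its own and that of [finvect_type].  Density depends on
    cardinals only, so the choice between the two does not affect it. *)
Lemma density_preimset (R : realType) (T T' : finType) (h : T' -> T)
    (P : {set T * T}) :
    bijective h ->
  density R [set u : T' * T' | (h u.1, h u.2) \in P] = density R P.
Proof.
move=> h_bij; rewrite /density (bij_eq_card h_bij); congr (_%:R / _).
pose hh (u : T' * T') := (h u.1, h u.2).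
rewrite -(@on_card_preimset _ _ hh P); last first.
  case: h_bij => g hK gK; apply: onW_bij; exists (fun u => (g u.1, g u.2)).
    by case=> x y; rewrite /hh /= !hK.
  by case=> x y; rewrite /hh /= !gK.
by congr #|pred_of_set _|; apply/setP=> u; rewrite !inE.
Qed.

Theorem corollary4 (R : realType) (p : nat) (p_prime : prime p) (c : R -> R)
    (c_bog : bilinear_bogolyubov_type 'F_p c) (n m : nat)
    (psi : {bilinear 'rV['F_p]_n -> 'rV['F_p]_n -> 'M['F_p]_m})
    (eps delta : R)
    (delta_def : delta = density R (low_rank_set psi eps))
    (delta_gt0 : 0 < delta) :
  exists (W1 W2 : {vspace 'rV['F_p]_n}) (r3 : nat)
    (Q : 'I_r3 -> {bilinear subvs_of W1 -> subvs_of W2 -> 'F_p | *%R & *%R}),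
    [/\ {subset bilinear_zeros Q <= low_rank_set psi (64 * eps)},
        (codim W1)%:R <= c delta,
        (codim W2)%:R <= c delta
      & r3%:R <= c delta].
Proof.
pose V : vectType 'F_p := 'rV['F_p]_n.
(* The Bogolyubov property speaks of [finvect_type V], whose finite type
   structure is not that of row vectors; [h] is the identity between them. *)
pose h (x : finvect_type V) : V := x.
pose P := [set u : finvect_type V * finvect_type V |
  (h u.1, h u.2) \in low_rank_set psi eps].
have densP : density R P = delta.
  by rewrite delta_def; apply: (@density_preimset R _ _ h); exists id.
have [_ /(_ V P)] := c_bog; rewrite densP => /(_ delta_gt0).
case=> W1 [W2 [r3 [Q [le_c subQ]]]]; exists W1, W2, r3, Q.
have le_cP k : (k <= maxn (codim W1) (maxn (codim W2) r3))%N -> k%:R <= c delta.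
  by move=> le_k; apply: le_trans le_c; rewrite ler_nat.
split; try by apply: le_cP; rewrite !leq_max leqnn ?orbT.
move=> u /subQ u_in; rewrite inE.
pose f (x y : finvect_type V) : 'M['F_p]_m := psi (h x) (h y).
apply: (@phiHVH_rank_le _ _ _ _ _ f P eps _ _ _ u u_in) => [y x1 x2|x y1 y2|v].
- exact: (linearBl psi).
- exact: (linearBr psi).
- by rewrite !inE.
Qed.
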